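(* Let $g$ be a (generally non-convex) differentiable function on $S_n(1)\times\mathbb{R}_+^m$ with $\|\nabla g(x)-\nabla g(y)\|_*\le L_g\|x-y\|$ for all $x,y\in S_n(1)\times\mathbb{R}^m_+$, and let $\min\{\mu_1,\mu_2\}>L_g$. For $x=(z_x,p_x)\in S_n(1)\times\mathbb{R}^m_+$ put $$f_{\mu_1,\mu_2}(x)=g(x)+\mu_1\sum_{k=1}^n (z_x)_k\ln (z_x)_k+\frac{\mu_2}{2}\|p_x\|_2^2 .$$ Then $$\psi^{lin}_\delta(x,y)=\langle\nabla g(y),x-y\rangle+\mu_1\langle\nabla KL(z_y|\mathbf 1),z_x-z_y\rangle+\mu_2\langle p_y,p_x-p_y\rangle$$ is a $(0,\ \max\{\mu_1,\mu_2\}+L_g,\ \min\{\mu_1,\mu_2\}-L_g)$-model of $f_{\mu_1,\mu_2}$ with respect to the Bregman divergence $V[y](x)=KL(z_x|z_y)+\frac12\|p_x-p_y\|_2^2$; that is, for all $x,y\in S_n(1)\times\mathbb{R}_+^m$ (with all entries of $z_y$ positive) $$f_{\mu_1,\mu_2}(y)+\psi^{lin}_\delta(x,y)+(\min\{\mu_1,\mu_2\}-L_g)V[y](x)\le f_{\mu_1,\mu_2}(x)$$ and $$f_{\mu_1,\mu_2}(x)\le f_{\mu_1,\mu_2}(y)+\psi^{lin}_\delta(x,y)+(\max\{\mu_1,\mu_2\}+L_g)V[y](x).$$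
   Context: $S_n(1)$ is the standard simplex in $\mathbb{R}^n$, $\mathbb{R}_+^m$ the non-negative orthant, $\mathbf 1=(1,\dots,1)^T$, $KL(z|t)=\sum_{k=1}^n z_k\ln(z_k/t_k)$ (with $0\ln0=0$), so $KL(z|\mathbf 1)=\sum_k z_k\ln z_k$; $\nabla KL(z_y|\mathbf 1)$ is the gradient in the first argument, with components $1+\ln (z_y)_k$. For $x=(z,p)\in\mathbb{R}^n\times\mathbb{R}^m$, $\|x\|^2=\|z\|_1^2+\|p\|_2^2$ with $\|\cdot\|_1$ the $\ell_1$ norm and $\|\cdot\|_2$ the Euclidean norm; $\|\cdot\|_*$ is the dual norm of $\|\cdot\|$. $(\delta,L,\mu)$-model (here with $\delta=0$ allowed): a function $\psi_\delta(x,y)$, convex in $x\in Q$ with $\psi_\delta(x,x)=0$, is a $(\delta,L,\mu)$-model of $f$ at $y$ with respect to $V$ if for all $x\in Q$: $\mu V[y](x)\le f(x)-(f(y)+\psi_\delta(x,y))\le LV[y](x)+\delta$. Here $Q=S_n(1)\times\mathbb{R}^m_+$. *)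

(* Defs.v *)
From HB Require Import structures.
From mathcomp Require Import all_boot all_order all_algebra.
From mathcomp Require Import all_classical all_reals all_analysis.
Set Implicit Arguments.
Unset Strict Implicit.
Unset Printing Implicit Defensive.
Import Order.TTheory GRing.Theory Num.Theory.
Import numFieldNormedType.Exports.
Local Open Scope classical_set_scope.
Local Open Scope ring_scope.

Definition simplex (R : realType) (n : nat) : set 'rV[R]_n :=
  [set z | (forall k, 0 <= z 0 k) /\ \sum_k z 0 k = 1].
Arguments simplex : clear implicits.

Definition orthant (R : realType) (m : nat) : set 'rV[R]_m :=
  [set p | forall k, 0 <= p 0 k].
Arguments orthant : clear implicits.

Definition feasible (R : realType) (n m : nat) : set ('rV[R]_n * 'rV[R]_m) :=
  simplex R n `*` orthant R m.
Arguments feasible : clear implicits.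

Definition dotp (R : realType) (n : nat) (u v : 'rV[R]_n) : R :=
  \sum_k u 0 k * v 0 k.

Definition dotp2 (R : realType) (n m : nat) (a x : 'rV[R]_n * 'rV[R]_m) : R :=
  dotp a.1 x.1 + dotp a.2 x.2.

Definition l1norm (R : realType) (n : nat) (z : 'rV[R]_n) : R :=
  \sum_k `|z 0 k|.

Definition l2norm (R : realType) (n : nat) (p : 'rV[R]_n) : R :=
  Num.sqrt (\sum_k p 0 k ^+ 2).

(* This is not the library norm on the product type, which is a maximum of
   sup norms. *)
Definition pnorm (R : realType) (n m : nat) (x : 'rV[R]_n * 'rV[R]_m) : R :=
  Num.sqrt (l1norm x.1 ^+ 2 + l2norm x.2 ^+ 2).

(* The supremum is over a nonempty set that is bounded (the dimension being
   finite), so the real-valued [sup] is the true supremum. *)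
Definition dual_pnorm (R : realType) (n m : nat) (a : 'rV[R]_n * 'rV[R]_m) : R :=
  sup [set dotp2 a x | x in [set x | pnorm x <= 1]].

(* [feasible R n m] has empty interior, so differentiability is taken relative
   to a set [D]: [a] is a gradient of [g] at [y] when
   g x = g y + <a, x - y> + o(|x - y|) as [x] tends to [y] within [D].
   Such an [a] need not be unique, but <a, x - y> is determined for [x], [y] in a
   convex [D].  If [g] is differentiable at [y] in the whole space, its gradient
   qualifies ([differentiable_is_gradient_within]).
   All norms being equivalent, the norm used inside the little-o does not
   matter. *)
Definition is_gradient_within (R : realType) (n m : nat)
    (D : set ('rV[R]_n * 'rV[R]_m)) (g : 'rV[R]_n * 'rV[R]_m -> R)
    (y a : 'rV[R]_n * 'rV[R]_m) : Prop :=
  forall x, (g x - g y - dotp2 a (x - y) : R^o)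
    =o_(x \near within D (nbhs y)) (x - y).

Lemma is_gradient_withinP (R : realType) (n m : nat)
    (D : set ('rV[R]_n * 'rV[R]_m)) (g : 'rV[R]_n * 'rV[R]_m -> R)
    (y a : 'rV[R]_n * 'rV[R]_m) :
  is_gradient_within D g y a <->
  forall eps : R, 0 < eps -> \forall x \near y, D x ->
    `|g x - g y - dotp2 a (x - y)| <= eps * `|x - y|.
Proof.
rewrite /is_gradient_within; split=> [dg eps e0|dg].
  have /eqoP/(_ _ e0) := funext dg.
  exact.
suff : (fun x => g x - g y - dotp2 a (x - y) : R^o)
    = [o_ (within D (nbhs y)) (fun x => x - y) of
        fun x => g x - g y - dotp2 a (x - y) : R^o].
  by rewrite funeqE.
by apply/eqoP => eps e0; exact: dg.
Qed.

Lemma differentiable_is_gradient_within (R : realType) (n m : nat)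
    (D : set ('rV[R]_n * 'rV[R]_m)) (g : 'rV[R]_n * 'rV[R]_m -> R^o)
    (y a : 'rV[R]_n * 'rV[R]_m) :
  differentiable g y -> (forall v, 'd g y v = dotp2 a v) ->
  is_gradient_within D g y a.
Proof.
move=> dg dga; apply/is_gradient_withinP => eps e0.
have /eqaddoP/(_ _ e0) : g = (fun x => g y + 'd g y (x - y)) +o_ (nbhs y) (fun x => x - y).
  by have /diffE dgE := dg; apply/funext => x; rewrite {1}dgE lim_id.
apply: filterS => x /= + _.
by rewrite -dga opprD addrA.
Qed.

Definition grad (R : realType) (n : nat) (h : 'rV[R]_n -> R) (z : 'rV[R]_n)
  : 'rV[R]_n := \row_k 'D_(delta_mx 0 k) (h : _ -> R^o) z.

(* The convention 0 ln 0 = 0 holds because the factor [z 0 k] vanishes. *)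
Definition KL (R : realType) (n : nat) (z t : 'rV[R]_n) : R :=
  \sum_k z 0 k * ln (z 0 k / t 0 k).

Definition grad_KL (R : realType) (n : nat) (z t : 'rV[R]_n) : 'rV[R]_n :=
  grad (fun z' => KL z' t) z.

Lemma grad_KL1E (R : realType) (n : nat) (z : 'rV[R]_n) (k : 'I_n) :
  (forall j, 0 < z 0 j) -> grad_KL z (const_mx 1) 0 k = 1 + ln (z 0 k).
Proof.
move=> z0; rewrite mxE; set phi := fun s : R^o => s * ln s : R^o.
transitivity ('D_(1 : R^o) phi (z 0 k)); last first.
  have dln := @is_derive1_ln R _ (z0 k).
  have did : is_derive (z 0 k : R^o) (1 : R^o) (id : R^o -> R^o) 1.
    exact: is_derive_id.
  have -> : phi = (id : R^o -> R^o) * (@ln R : R^o -> R^o) by [].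
  have [_ ->] := is_deriveM did dln.
  rewrite /GRing.scale /= mulfV ?gt_eqF ?z0 // mulr1 //.
rewrite /derive.
apply: (congr1 (fun F : R -> R^o => lim (F @ 0^'))).
apply/funext => h /=; congr (_ *: _).
rewrite /KL -sumrB (bigD1 k) //= big1 ?addr0 => [|j jk].
  by rewrite /phi !mxE !eqxx !divr1 /GRing.scale /=.
by rewrite !mxE eqxx /= (negbTE jk) mulr0 add0r subrr.
Qed.

Definition bregman (R : realType) (n m : nat) (y x : 'rV[R]_n * 'rV[R]_m) : R :=
  KL x.1 y.1 + l2norm (x.2 - y.2) ^+ 2 / 2.

(* [psi] is a (delta, L, mu)-model of [f] at [y] with respect to [V] on [Q];
   [V y x] stands for V[y](x). *)
Definition is_model (R : realType) (E : lmodType R) (Q : set E)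
    (V : E -> E -> R) (delta L mu : R) (f : E -> R) (psi : E -> E -> R)
    (y : E) : Prop :=
  [/\ convex_function Q (fun x => psi x y),
      forall x, Q x -> psi x x = 0
    & forall x, Q x ->
        mu * V y x <= f x - (f y + psi x y) /\
        f x - (f y + psi x y) <= L * V y x + delta].

Definition f_reg (R : realType) (n m : nat) (g : 'rV[R]_n * 'rV[R]_m -> R)
    (mu1 mu2 : R) (x : 'rV[R]_n * 'rV[R]_m) : R :=
  g x + mu1 * (\sum_k x.1 0 k * ln (x.1 0 k)) + mu2 / 2 * l2norm x.2 ^+ 2.

Definition psi_lin (R : realType) (n m : nat)
    (G : 'rV[R]_n * 'rV[R]_m -> 'rV[R]_n * 'rV[R]_m)
    (mu1 mu2 : R) (x y : 'rV[R]_n * 'rV[R]_m) : R :=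
  dotp2 (G y) (x - y)
  + mu1 * dotp (grad_KL y.1 (const_mx 1)) (x.1 - y.1)
  + mu2 * dotp y.2 (x.2 - y.2).

(* Main.v *)
Require Import Defs.
From HB Require Import structures.
From mathcomp Require Import all_boot all_order all_algebra.
From mathcomp Require Import all_classical all_reals all_analysis.
From mathcomp Require Import ring lra.
Import Order.TTheory GRing.Theory Num.Theory.
Import numFieldNormedType.Exports.
Local Open Scope classical_set_scope.
Local Open Scope ring_scope.

Set Implicit Arguments.
Unset Strict Implicit.

(** Subtracting from [f_reg g mu1 mu2] its linearization [psi_lin] at [y] leaves
    three remainders: the first-order remainder of [g], and the Bregman
    remainders of the entropy and of half the squared Euclidean norm, weighted
    by [mu1] and [mu2] ([f_reg_remainder]).  The last two are exactly the two
    nonnegative summands of [bregman y x] (for the entropy this uses that both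
    points have total mass 1, [KL_entropy_remainder]), so their weighted sum
    lies between [min mu1 mu2] and [max mu1 mu2] times [bregman y x].

    It remains to see that the remainder of [g] is at most [Lg * bregman y x] in
    absolute value.  The Lipschitz condition on the gradient, integrated along
    the segment from [y] to [x], bounds it by [Lg / 2 * pnorm (x - y) ^+ 2]
    ([gradient_remainder_le]).  Pinsker's inequality [KL_pinsker] turns the
    squared l1 norm in [pnorm] into twice the relative entropy, which gives
    [pnorm (x - y) ^+ 2 / 2 <= bregman y x] ([pnorm_sqr_le_bregman]).

    [psi_lin] is affine in its first argument, hence convex. *)

(** * Pinsker's inequality *)

(** The rational function has the derivatives of [ln] up to order 3 at 1,
    so that the derivative of the gap is a cube times a positive factor and
    changes sign only at 1. *)
Lemma ln_pade_gap_is_derive (R : realType) (t : R) : 0 < t ->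
  is_derive t (1 : R)
    (fun s : R => ln s - (s - 1) * (5 * s + 1) / (2 * s * (s + 2)))
    ((t - 1) ^+ 3 / (t ^+ 2 * (t + 2) ^+ 2)).
Proof.
move=> t0; have dln := is_derive1_ln t0.
have den0 : 2 * t * (t + 2) != 0 by rewrite gt_eqF// !mulr_gt0//; lra.
have dnum : is_derive t (1 : R) (fun s : R => (s - 1) * (5 * s + 1)) (10 * t - 4).
  apply: (@is_derive_eq _ _ _ _ _ _ _ _ (is_deriveM _ _)).
  by rewrite /GRing.scale /=; ring.
have dden : is_derive t (1 : R) (fun s : R => 2 * s * (s + 2)) (4 * t + 4).
  apply: (@is_derive_eq _ _ _ _ _ _ _ _ (is_deriveM _ _)).
  by rewrite /GRing.scale /=; ring.
have dinv := @is_deriveV R (fun s : R => 2 * s * (s + 2)) _ _ _ den0 dden.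
apply: (@is_derive_eq _ _ _ _ _ _ _ _ (is_deriveB dln (is_deriveM dnum dinv))).
rewrite /GRing.scale /=; field.
by rewrite !gt_eqF//; lra.
Qed.

(** The gap decreases on ]0, 1], increases on [1, +oo[ and vanishes at 1. *)
Lemma ln_pade_gap_ge0 (R : realType) (t : R) : 0 < t ->
  0 <= ln t - (t - 1) * (5 * t + 1) / (2 * t * (t + 2)).
Proof.
move=> t0; set f := fun s : R => ln s - (s - 1) * (5 * s + 1) / (2 * s * (s + 2)).
set df := fun c : R => (c - 1) ^+ 3 / (c ^+ 2 * (c + 2) ^+ 2).
rewrite -/(f t); have f1 : f 1 = 0 by rewrite /f ln1 subrr !mul0r subrr.
have cont a b : 0 < a -> {within `[a, b], continuous f}.
  move=> a0; apply: derivable_within_continuous => x; rewrite in_itv/= => /andP[ax _].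
  by have [] := ln_pade_gap_is_derive (lt_le_trans a0 ax).
have sqden (c : R) : 0 <= c ^+ 2 * (c + 2) ^+ 2 by rewrite mulr_ge0// sqr_ge0.
have [t1|t1|->] := ltgtP t 1; last by rewrite f1.
- have [|c] := @MVT R f df _ _ t1 _ (cont t 1 t0).
    by move=> x; rewrite in_itv/= => /andP[tx _]; apply: ln_pade_gap_is_derive; lra.
  rewrite in_itv/= f1 sub0r => /andP[tc c1] E.
  rewrite -oppr_le0 E mulr_le0_ge0//; last lra.
  by rewrite mulr_le0_ge0 ?invr_ge0// exprS mulr_le0_ge0 ?sqr_ge0//; lra.
- have [|c] := @MVT R f df _ _ t1 _ (cont 1 t ltr01).
    by move=> x; rewrite in_itv/= => /andP[tx _]; apply: ln_pade_gap_is_derive; lra.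
  rewrite in_itv/= f1 subr0 => /andP[tc c1] ->.
  by rewrite mulr_ge0 ?divr_ge0 ?exprn_ge0//; lra.
Qed.

(** The pointwise form of Pinsker's inequality: this is [ln_pade_gap_ge0]
    multiplied by the positive factor [2 * t * (t + 2)]. *)
Lemma sqr_le_entropy (R : realType) (t : R) : 0 <= t ->
  3 * (t - 1) ^+ 2 <= (2 * t + 4) * (t * ln t - t + 1).
Proof.
rewrite le_eqVlt => /predU1P[<-|t0]; first by rewrite mul0r; lra.
have : 0 <= 2 * t * (t + 2) *
    (ln t - (t - 1) * (5 * t + 1) / (2 * t * (t + 2))).
  by rewrite mulr_ge0 ?ln_pade_gap_ge0// !mulr_ge0; lra.
have -> : 2 * t * (t + 2) * (ln t - (t - 1) * (5 * t + 1) / (2 * t * (t + 2)))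
    = 2 * t * (t + 2) * ln t - (t - 1) * (5 * t + 1).
  by field; rewrite !gt_eqF//; lra.
by rewrite !mulrDr; lra.
Qed.

(** With [t := p / q], [sqr_le_entropy] and the arithmetic-geometric mean
    inequality give [S * |t - 1| <= S^2 * w / 4 + (t * ln t - t + 1)] for
    [w := (2 * t + 4) / 3]; this is multiplied by [q] here.  The parameter [S]
    replaces the Cauchy-Schwarz step: for [S] the l1 distance, the left-hand
    sides add up to [S ^+ 2]. *)
Lemma pinsker_summand (R : realType) (p q S : R) : 0 <= p -> 0 < q ->
  S * `|p - q| <=
    S ^+ 2 / 4 * ((2 * p + 4 * q) / 3) + (p * ln (p / q) - p + q).
Proof.
move=> p0 q0; set t := p / q.
have pE : p = t * q by rewrite /t divfK// gt_eqF.
have t0 : 0 <= t by rewrite divr_ge0// ltW.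
have := sqr_le_entropy t0; set e := t * ln t - t + 1 => te.
have -> : p * ln t - p + q = q * e by rewrite /e {1 2}pE; ring.
have -> : `|p - q| = q * `|t - 1|.
  by rewrite -[X in X * _](gtr0_norm q0) -normrM pE; congr `|_|; ring.
have -> : S ^+ 2 / 4 * ((2 * p + 4 * q) / 3) + q * e =
    q * (S ^+ 2 / 4 * ((2 * t + 4) / 3) + e) by rewrite pE; ring.
rewrite mulrCA ler_pM2l// -subr_ge0.
move: te; rewrite -real_normK ?num_real//; set u := `|t - 1| => te.
have w0 : 0 < 2 * t + 4 by lra.
rewrite -(pmulr_rge0 _ w0).
have : 0 <= (S * (2 * t + 4) - 6 * u) ^+ 2 by exact: sqr_ge0.
move: te; set w := 2 * t + 4.
have -> : w * (S ^+ 2 / 4 * (w / 3) + e - S * u) =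
  (S * w - 6 * u) ^+ 2 / 12 + (w * e - 3 * u ^+ 2) by field.
lra.
Qed.

(** Summing [pinsker_summand] with [S] the l1 distance: the weights
    [(2 * z_k + 4 * t_k) / 3] add up to 2, so [S^2 <= S^2 / 2 + KL z t]. *)
Lemma KL_pinsker (R : realType) (n : nat) (z t : 'rV[R]_n) :
  simplex R n z -> simplex R n t -> (forall k, 0 < t 0 k) ->
  l1norm (z - t) ^+ 2 / 2 <= KL z t.
Proof.
move=> [z0 z1] [_ t1] t0; set S := l1norm (z - t).
suff : S * S <= S ^+ 2 / 2 + KL z t by rewrite -expr2; lra.
rewrite {2}/S /l1norm mulr_sumr.
have -> : S ^+ 2 / 2 + KL z t =
  \sum_k (S ^+ 2 / 4 * ((2 * z 0 k + 4 * t 0 k) / 3) +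
    (z 0 k * ln (z 0 k / t 0 k) - z 0 k + t 0 k)).
  rewrite big_split/= -mulr_sumr -mulr_suml !big_split/= -!mulr_sumr sumrN z1 t1.
  by rewrite /KL; field.
by apply: ler_sum => k _; rewrite !mxE; exact: pinsker_summand.
Qed.

(** * The product norm and its dual *)

Lemma l1norm_ge0 (R : realType) (n : nat) (z : 'rV[R]_n) : 0 <= l1norm z.
Proof. exact: sumr_ge0. Qed.

Lemma pnorm_sqr (R : realType) (n m : nat) (x : 'rV[R]_n * 'rV[R]_m) :
  pnorm x ^+ 2 = l1norm x.1 ^+ 2 + l2norm x.2 ^+ 2.
Proof. by rewrite sqr_sqrtr// addr_ge0// sqr_ge0. Qed.

Lemma l2norm_sqr (R : realType) (n : nat) (p : 'rV[R]_n) :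
  l2norm p ^+ 2 = \sum_k p 0 k ^+ 2.
Proof. by rewrite sqr_sqrtr// sumr_ge0// => k _; rewrite sqr_ge0. Qed.

Lemma pnorm_ge0 (R : realType) (n m : nat) (x : 'rV[R]_n * 'rV[R]_m) :
  0 <= pnorm x.
Proof. exact: sqrtr_ge0. Qed.

Lemma pnormZ (R : realType) (n m : nat) (c : R) (x : 'rV[R]_n * 'rV[R]_m) :
  pnorm (c *: x) = `|c| * pnorm x.
Proof.
apply/eqP; rewrite -(@eqrXn2 _ 2)// ?mulr_ge0 ?pnorm_ge0//; apply/eqP.
rewrite exprMn !pnorm_sqr !l2norm_sqr mulrDr -exprMn; congr (_ ^+ 2 + _).
  by rewrite /l1norm mulr_sumr; apply: eq_bigr => k _; rewrite mxE normrM.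
by rewrite real_normK ?num_real// mulr_sumr; apply: eq_bigr => k _; rewrite mxE exprMn.
Qed.

Lemma pnorm_fst_le (R : realType) (n m : nat) (x : 'rV[R]_n * 'rV[R]_m) k :
  `|x.1 0 k| <= pnorm x.
Proof.
apply: (@le_trans _ _ (l1norm x.1)).
  by rewrite /l1norm (bigD1 k)//= lerDl sumr_ge0.
rewrite -(@ler_pXn2r _ 2) ?nnegrE ?l1norm_ge0 ?pnorm_ge0//.
by rewrite pnorm_sqr lerDl sqr_ge0.
Qed.

Lemma pnorm_snd_le (R : realType) (n m : nat) (x : 'rV[R]_n * 'rV[R]_m) k :
  `|x.2 0 k| <= pnorm x.
Proof.
rewrite -(@ler_pXn2r _ 2) ?nnegrE ?normr_ge0 ?pnorm_ge0//.
rewrite pnorm_sqr l2norm_sqr real_normK ?num_real// (bigD1 k)//=.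
rewrite addrCA lerDl addr_ge0 ?sqr_ge0// sumr_ge0// => j _; exact: sqr_ge0.
Qed.

Lemma pnorm_eq0 (R : realType) (n m : nat) (x : 'rV[R]_n * 'rV[R]_m) :
  pnorm x = 0 -> x = 0.
Proof.
case: x => z p x0; congr pair; apply/rowP => k; rewrite mxE; apply/eqP;
  rewrite -normr_le0 -x0; [exact: (pnorm_fst_le (z, p))|exact: (pnorm_snd_le (z, p))].
Qed.

Lemma dotp2Z (R : realType) (n m : nat) (c : R) (a x : 'rV[R]_n * 'rV[R]_m) :
  dotp2 a (c *: x) = c * dotp2 a x.
Proof.
rewrite /dotp2 /dotp mulrDr !mulr_sumr.
by congr (_ + _); apply: eq_bigr => k _; rewrite mxE; ring.
Qed.

Lemma dotp2Bl (R : realType) (n m : nat) (a b x : 'rV[R]_n * 'rV[R]_m) :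
  dotp2 (a - b) x = dotp2 a x - dotp2 b x.
Proof.
rewrite /dotp2 /dotp opprD addrACA -!sumrB.
by congr (_ + _); apply: eq_bigr => k _; rewrite !mxE; ring.
Qed.

(** The supremum defining [dual_pnorm] bounds its members only once the set is
    known to be bounded; here every coordinate of a vector of the unit ball is
    at most 1, so the sum of the [|a_k|] is an upper bound. *)
Lemma dotp2_dual_pnorm_le (R : realType) (n m : nat)
    (a x : 'rV[R]_n * 'rV[R]_m) :
  dotp2 a x <= dual_pnorm a * pnorm x.
Proof.
have unit_le v : pnorm v <= 1 -> dotp2 a v <= dual_pnorm a.
  move=> v1; apply: ub_le_sup; last by exists v.
  exists (\sum_k `|a.1 0 k| + \sum_k `|a.2 0 k|) => _ [w /= w1 <-].
  by rewrite lerD//; apply: ler_sum => k _; apply: (le_trans (ler_norm _));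
    rewrite normrM ler_piMr//; apply: le_trans w1;
    [exact: pnorm_fst_le|exact: pnorm_snd_le].
have [x0|xn0] := eqVneq (pnorm x) 0.
  by rewrite x0 (pnorm_eq0 x0) mulr0 -(scale0r 0) dotp2Z mul0r.
have xp : 0 < pnorm x by rewrite lt_neqAle eq_sym xn0 pnorm_ge0.
rewrite -ler_pdivrMr// mulrC -dotp2Z unit_le// pnormZ.
by rewrite ger0_norm ?invr_ge0 ?pnorm_ge0// mulVf.
Qed.

Lemma norm_dotp2_dual_pnorm_le (R : realType) (n m : nat)
    (a x : 'rV[R]_n * 'rV[R]_m) :
  `|dotp2 a x| <= dual_pnorm a * pnorm x.
Proof.
rewrite ler_norml dotp2_dual_pnorm_le andbT lerNl -mulN1r -dotp2Z.
by rewrite (le_trans (dotp2_dual_pnorm_le _ _))// pnormZ normrN1 mul1r.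
Qed.

(** * First-order remainders along a segment *)

Lemma is_derive_first_order (R : realType) (f : R -> R) (t df : R) :
  (forall eps : R, 0 < eps -> \forall s \near t,
     `|f s - f t - df * (s - t)| <= eps * `|s - t|) ->
  is_derive t (1 : R) f df.
Proof.
move=> fo.
have cv : (fun h : R => h^-1 *: ((f \o shift t) (h *: (1 : R)) - f t)) @ 0^' --> df.
  apply/cvgrPdist_le => eps eps0.
  have /nbhs0P near0 := fo eps eps0.
  near=> h.
  have h0 : h != 0 by near: h; exact: nbhs_dnbhs_neq.
  have : `|f (t + h) - f t - df * ((t + h) - t)| <= eps * `|(t + h) - t|.
    by near: h; apply: nbhs_dnbhs; exact: near0.
  rewrite (_ : t + h - t = h); last by ring.
  move=> fh.
  rewrite /= /GRing.scale/= mulr1 (addrC h t) distrC.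
  rewrite (_ : _ - df = h^-1 * (f (t + h) - f t - df * h)); last by field.
  by rewrite normrM normfV ler_pdivrMl ?normr_gt0// (mulrC `|h|).
by split; [exact: cvgP cv|exact: cvg_lim cv].
Unshelve. all: by end_near. Qed.

(** Within distance [eps / (1 + |df t|)] of [t] the expansion, used with the
    slope error 1, keeps [f] within [eps] of [f t]. *)
Lemma first_order_le_continuous (R : realType) (A : set R) (f df : R -> R) :
  (forall t, A t -> forall eps : R, 0 < eps -> \forall s \near t, A s ->
     `|f s - f t - df t * (s - t)| <= eps * `|s - t|) ->
  {within A, continuous f}.
Proof.
move=> fo; apply/subspace_continuousP => t At; apply/cvgrPdist_le => eps eps0.
rewrite near_withinE.
set K := 1 + `|df t|; have K0 : 0 < K by rewrite ltr_pwDl.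
have e0 : 0 < eps / K by rewrite divr_gt0.
near=> s => As.
have fs : `|f s - f t - df t * (s - t)| <= 1 * `|s - t|.
  by move: As; near: s; apply: fo.
have st : `|t - s| <= eps / K by near: s; exact: cvgr_dist_le e0.
rewrite distrC -[X in `|X|](subrK (df t * (s - t))) (le_trans (ler_normD _ _))//.
rewrite normrM (le_trans (lerD fs (lexx _)))// -mulrDl -/K distrC.
by rewrite mulrC -ler_pdivlMr.
Unshelve. all: by end_near. Qed.

(** At the endpoints of [0, 1] the expansion is only one-sided, which gives
    continuity there; the derivative exists inside.  This suffices for the mean
    value theorem, applied to [f t - t * (df 0 + C / 2 * t)], whose derivative
    [df t - df 0 - C * t] is nonpositive. *)
Lemma first_order_remainder_le (R : realType) (f df : R -> R) (C : R) :
  (forall t : R, `[0, 1]%classic t -> forall eps : R, 0 < eps ->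
     \forall s \near t, `[0, 1]%classic s ->
     `|f s - f t - df t * (s - t)| <= eps * `|s - t|) ->
  (forall t : R, 0 <= t <= 1 -> df t - df 0 <= C * t) ->
  f 1 - f 0 - df 0 <= C / 2.
Proof.
move=> fo lip.
set h := fun t : R => f t - (t * (df 0 + C / 2 * t)).
have dpoly (t : R) : is_derive t (1 : R)
    (fun t : R => t * (df 0 + C / 2 * t)) (df 0 + C * t).
  apply: (@is_derive_eq _ _ _ _ _ _ _ _ (is_deriveM _ _)).
  by rewrite /GRing.scale /=; field.
have dh (t : R) : t \in `]0, 1[%R -> is_derive t (1 : R) h (df t - (df 0 + C * t)).
  move=> t01; apply: is_deriveB; apply: is_derive_first_order => eps eps0.
  have : \forall s \near t, s \in `]0, 1[%R by exact: near_in_itvoo.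
  have tcc : `[0, 1]%classic t by exact: subset_itv_oo_cc.
  apply: filterS2 (fo _ tcc _ eps0) => s + s01; apply.
  exact: subset_itv_oo_cc.
have cpoly : {within `[0, 1], continuous (fun t : R => t * (df 0 + C / 2 * t))}.
  by apply: derivable_within_continuous => s _; have [] := dpoly s.
have ch : {within `[0, 1], continuous h}.
  by move=> t; apply: cvgB; [exact: (first_order_le_continuous fo)|exact: cpoly].
have [c] := MVT ltr01 dh ch.
rewrite in_itv/= => /andP[c0 c1]; have := lip c.
rewrite (ltW c0) (ltW c1) => /(_ isT).
by rewrite /h subr0 !mulr1 => + E; lra.
Qed.

(** The descent lemma, for a gradient relative to a set [D] that need not have
    interior points: only the restriction of [g] to the segment from [y] to [x]
    matters.  The two signs come from [first_order_remainder_le] applied to this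
    restriction and to its opposite. *)
Lemma gradient_remainder_le (R : realType) (n m : nat)
    (D : set ('rV[R]_n * 'rV[R]_m)) (g : 'rV[R]_n * 'rV[R]_m -> R)
    (G : 'rV[R]_n * 'rV[R]_m -> 'rV[R]_n * 'rV[R]_m) (L : R)
    (x y : 'rV[R]_n * 'rV[R]_m) :
  (forall z, D z -> is_gradient_within D g z (G z)) ->
  (forall z, D z -> dual_pnorm (G z - G y) <= L * pnorm (z - y)) ->
  (forall t : R, 0 <= t <= 1 -> D (y + t *: (x - y))) ->
  `|g x - g y - dotp2 (G y) (x - y)| <= L / 2 * pnorm (x - y) ^+ 2.
Proof.
move=> gG lip seg; set d := x - y; set c := fun t : R => y + t *: d.
have c1 : c 1 = x by rewrite /c scale1r addrC subrK.
have c0 : c 0 = y by rewrite /c scale0r addr0.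
set f := g \o c; set df := fun t => dotp2 (G (c t)) d.
have fo (t : R) : `[0, 1]%classic t -> forall eps : R, 0 < eps ->
    \forall s \near t, `[0, 1]%classic s ->
    `|f s - f t - df t * (s - t)| <= eps * `|s - t|.
  rewrite /= in_itv/= => t01 eps eps0.
  (* Along the segment distances are multiplied by [`|d|]; the 1 keeps the
     denominator positive when [d = 0]. *)
  set e := eps / (1 + `|d|).
  have d0 : 0 < 1 + `|d| by rewrite ltr_pwDl.
  have e0 : 0 < e by rewrite divr_gt0.
  have ct : {for t, continuous c}.
    by apply: cvgD; [exact: cvg_cst|apply: cvgZr_tmp; exact: cvg_id].
  have /is_gradient_withinP /(_ _ e0) near_ct := gG _ (seg t t01).
  have near_t : \forall s \near t, D (c s) ->
      `|g (c s) - g (c t) - dotp2 (G (c t)) (c s - c t)| <= e * `|c s - c t|.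
    exact: ct near_ct.
  apply: filterS near_t => s + s01; move/(_ (seg s s01)).
  have -> : c s - c t = (s - t) *: d.
    by rewrite /c opprD addrACA subrr add0r scalerBl.
  rewrite -/(c s) -/(c t) dotp2Z normrZ mulrC => /le_trans; apply.
  rewrite mulrCA [leRHS]mulrC ler_wpM2l// /e mulrAC ler_pdivrMr//.
  by rewrite ler_pM2l// lerDr.
have dlip (t : R) : 0 <= t <= 1 ->
    `|df t - df 0| <= L * pnorm d ^+ 2 * t.
  move=> t01; rewrite /df c0 -dotp2Bl (le_trans (norm_dotp2_dual_pnorm_le _ _))//.
  have := lip _ (seg t t01); rewrite -/(c t) {2}/c addrAC subrr add0r pnormZ.
  rewrite ger0_norm; last by case/andP: t01.
  move=> /(ler_wpM2r (pnorm_ge0 d)) /le_trans; apply.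
  by rewrite le_eqVlt; apply/orP; left; apply/eqP; ring.
have up : f 1 - f 0 - df 0 <= L * pnorm d ^+ 2 / 2.
  by apply: first_order_remainder_le fo _ => t /dlip; rewrite ler_norml => /andP[].
have lo : - f 1 - - f 0 - - df 0 <= L * pnorm d ^+ 2 / 2.
  apply: (@first_order_remainder_le _ (fun t => - f t) (fun t => - df t)) =>
    [t t01 eps eps0|t /dlip].
    apply: filterS (fo t t01 eps eps0) => s + s01; move/(_ s01).
    by rewrite mulNr -!opprD normrN.
  by rewrite ler_norml => /andP[+ _]; lra.
move: up lo; rewrite /df /f /= c0 c1 => up lo.
by rewrite ler_norml; apply/andP; split; lra.
Qed.

(** * Bregman remainders of the regularizers *)

Lemma dotp_affine (R : realType) (n : nat) (a u v y : 'rV[R]_n) (t : R) :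
  dotp a (t *: u + (1 - t) *: v - y) =
  t * dotp a (u - y) + (1 - t) * dotp a (v - y).
Proof.
rewrite /dotp !mulr_sumr -big_split; apply: eq_bigr => k _.
by rewrite !mxE /=; ring.
Qed.

Lemma dotp0 (R : realType) (n : nat) (a : 'rV[R]_n) : dotp a 0 = 0.
Proof. by rewrite /dotp big1// => k _; rewrite mxE mulr0. Qed.

Lemma feasible_segment (R : realType) (n m : nat)
    (x y : 'rV[R]_n * 'rV[R]_m) (t : R) :
  feasible R n m x -> feasible R n m y -> 0 <= t <= 1 ->
  feasible R n m (y + t *: (x - y)).
Proof.
move=> [[x0 x1] xp] [[y0 y1] yp] /andP[t0 t1].
have conv (a b : R) : 0 <= a -> 0 <= b -> 0 <= b + t * (a - b).
  move=> a0 b0; rewrite (_ : b + _ = t * a + (1 - t) * b); last by ring.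
  by rewrite addr_ge0// mulr_ge0// subr_ge0.
split=> [|k]; last by rewrite !mxE conv.
split=> [k|]; first by rewrite !mxE conv.
under eq_bigr do rewrite !mxE.
by rewrite big_split/= -mulr_sumr sumrB x1 y1 subrr mulr0 addr0.
Qed.

(** The coordinatewise difference of the two sides is [t_k - z_k], and its sum
    is 0 because both vectors have total mass 1. *)
Lemma KL_entropy_remainder (R : realType) (n : nat) (z t : 'rV[R]_n) :
  simplex R n z -> simplex R n t -> (forall k, 0 < t 0 k) ->
  \sum_k z 0 k * ln (z 0 k) - \sum_k t 0 k * ln (t 0 k)
    - dotp (grad_KL t (const_mx 1)) (z - t) = KL z t.
Proof.
move=> [z0 z1] [_ t1] t0.
have -> : KL z t = \sum_k (z 0 k * ln (z 0 k / t 0 k) - z 0 k + t 0 k).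
  by rewrite !big_split/= sumrN z1 t1 subrK.
rewrite /dotp -!sumrB; apply: eq_bigr => k _.
rewrite grad_KL1E// !mxE.
have := z0 k; rewrite le_eqVlt => /predU1P[<-|zk]; first by rewrite !mul0r; ring.
by rewrite lnM ?posrE ?invr_gt0// lnV ?posrE//; ring.
Qed.

Lemma l2norm_sqr_remainder (R : realType) (n : nat) (p q : 'rV[R]_n) :
  l2norm p ^+ 2 / 2 - l2norm q ^+ 2 / 2 - dotp q (p - q)
    = l2norm (p - q) ^+ 2 / 2.
Proof.
rewrite !l2norm_sqr /dotp !mulr_suml -!sumrB; apply: eq_bigr => k _.
by rewrite !mxE; field.
Qed.

Lemma f_reg_remainder (R : realType) (n m : nat)
    (g : 'rV[R]_n * 'rV[R]_m -> R)
    (G : 'rV[R]_n * 'rV[R]_m -> 'rV[R]_n * 'rV[R]_m)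
    (mu1 mu2 : R) (x y : 'rV[R]_n * 'rV[R]_m) :
  feasible R n m x -> feasible R n m y -> (forall k, 0 < y.1 0 k) ->
  f_reg g mu1 mu2 x - (f_reg g mu1 mu2 y + psi_lin G mu1 mu2 x y) =
  (g x - g y - dotp2 (G y) (x - y)) + mu1 * KL x.1 y.1
    + mu2 * (l2norm (x.2 - y.2) ^+ 2 / 2).
Proof.
move=> [x1 _] [y1 _] y0; rewrite -KL_entropy_remainder// -l2norm_sqr_remainder.
by rewrite /f_reg /psi_lin; field.
Qed.

Lemma psi_lin_convex (R : realType) (n m : nat)
    (Q : set ('rV[R]_n * 'rV[R]_m))
    (G : 'rV[R]_n * 'rV[R]_m -> 'rV[R]_n * 'rV[R]_m)
    (mu1 mu2 : R) (y : 'rV[R]_n * 'rV[R]_m) :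
  convex_function Q (fun x => psi_lin G mu1 mu2 x y).
Proof.
move=> t u v _ _; rewrite convRE /psi_lin /dotp2 /conv /=.
rewrite /unstable.onem !dotp_affine le_eqVlt; apply/orP; left; apply/eqP; ring.
Qed.

Lemma psi_lin_diag (R : realType) (n m : nat)
    (G : 'rV[R]_n * 'rV[R]_m -> 'rV[R]_n * 'rV[R]_m)
    (mu1 mu2 : R) (x : 'rV[R]_n * 'rV[R]_m) : psi_lin G mu1 mu2 x x = 0.
Proof. by rewrite /psi_lin /dotp2 !subrr !dotp0 !mulr0 !addr0. Qed.

(** * The model inequalities *)

Lemma pnorm_sqr_le_bregman (R : realType) (n m : nat)
    (x y : 'rV[R]_n * 'rV[R]_m) :
  feasible R n m x -> feasible R n m y -> (forall k, 0 < y.1 0 k) ->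
  pnorm (x - y) ^+ 2 / 2 <= bregman y x.
Proof.
move=> [x1 _] [y1 _] y0.
by rewrite pnorm_sqr mulrDl /bregman lerD2r; exact: KL_pinsker.
Qed.

(** A dual norm is nonnegative, so two distinct points satisfying the Lipschitz
    bound already force the sign of the constant. *)
Lemma lipschitz_gradient_const_ge0 (R : realType) (n m : nat)
    (G : 'rV[R]_n * 'rV[R]_m -> 'rV[R]_n * 'rV[R]_m)
    (L : R) (x y : 'rV[R]_n * 'rV[R]_m) :
  dual_pnorm (G x - G y) <= L * pnorm (x - y) -> x != y -> 0 <= L.
Proof.
move=> lip xy; have d0 : 0 < pnorm (x - y).
  rewrite lt_neqAle pnorm_ge0 andbT eq_sym; apply: contra_neq xy => /pnorm_eq0.
  by move/eqP; rewrite subr_eq0 => /eqP.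
have := le_trans (normr_ge0 _) (norm_dotp2_dual_pnorm_le (G x - G y) (x - y)).
rewrite pmulr_lge0// => /le_trans /(_ lip).
by rewrite pmulr_lge0.
Qed.

(** Passing from [L / 2 * pnorm (x - y) ^+ 2] to [L * bregman y x] uses
    [0 <= L], which holds when [x] and [y] differ; for [x = y] both sides of the
    claim vanish. *)
Lemma gradient_remainder_le_bregman (R : realType) (n m : nat)
    (g : 'rV[R]_n * 'rV[R]_m -> R)
    (G : 'rV[R]_n * 'rV[R]_m -> 'rV[R]_n * 'rV[R]_m)
    (L : R) (x y : 'rV[R]_n * 'rV[R]_m) :
  (forall z, feasible R n m z -> is_gradient_within (feasible R n m) g z (G z)) ->
  (forall z, feasible R n m z ->
    dual_pnorm (G z - G y) <= L * pnorm (z - y)) ->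
  feasible R n m x -> feasible R n m y -> (forall k, 0 < y.1 0 k) ->
  `|g x - g y - dotp2 (G y) (x - y)| <= L * bregman y x.
Proof.
move=> gG lip Qx Qy y0.
have breg := pnorm_sqr_le_bregman Qx Qy y0.
have : `|g x - g y - dotp2 (G y) (x - y)| <= L / 2 * pnorm (x - y) ^+ 2.
  by apply: gradient_remainder_le gG lip _ => t; exact: feasible_segment.
have [->|xy] := eqVneq x y.
  move=> _; rewrite !subrr /dotp2 !dotp0 addr0 subr0 normr0 /bregman subrr /KL.
  rewrite big1 => [|k _]; last by rewrite divff ?gt_eqF// ln1 mulr0.
  by rewrite l2norm_sqr big1 ?mul0r ?addr0 ?mulr0// => k _; rewrite mxE expr0n.
move=> /le_trans; apply; rewrite mulrAC -mulrA ler_wpM2l//.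
exact: lipschitz_gradient_const_ge0 (lip _ Qx) xy.
Qed.

Unset Implicit Arguments.

Theorem mainTheorem6 (R : realType) (n m : nat)
    (g : 'rV[R]_n * 'rV[R]_m -> R)
    (G : 'rV[R]_n * 'rV[R]_m -> 'rV[R]_n * 'rV[R]_m)
    (Lg mu1 mu2 : R)
    (g_diff : forall y, feasible R n m y ->
      is_gradient_within (feasible R n m) g y (G y))
    (G_lip : forall x y, feasible R n m x -> feasible R n m y ->
      dual_pnorm (G x - G y) <= Lg * pnorm (x - y))
    (mu_gt : Lg < Num.min mu1 mu2) :
  forall y, feasible R n m y -> (forall k, 0 < y.1 0 k) ->
    is_model (feasible R n m) (@bregman R n m)
      0 (Num.max mu1 mu2 + Lg) (Num.min mu1 mu2 - Lg)
      (f_reg g mu1 mu2) (psi_lin G mu1 mu2) y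
    /\ forall x, feasible R n m x ->
      f_reg g mu1 mu2 y + psi_lin G mu1 mu2 x y
          + (Num.min mu1 mu2 - Lg) * bregman y x
        <= f_reg g mu1 mu2 x
      /\ f_reg g mu1 mu2 x
        <= f_reg g mu1 mu2 y + psi_lin G mu1 mu2 x y
          + (Num.max mu1 mu2 + Lg) * bregman y x.
Proof.
move=> y Qy y0; set mmin := Num.min mu1 mu2; set mmax := Num.max mu1 mu2.
have bounds x : feasible R n m x ->
    (mmin - Lg) * bregman y x
      <= f_reg g mu1 mu2 x - (f_reg g mu1 mu2 y + psi_lin G mu1 mu2 x y)
      <= (mmax + Lg) * bregman y x.
  move=> Qx; rewrite f_reg_remainder//.
  have := gradient_remainder_le_bregman g_diff (fun z Qz => G_lip z y Qz Qy) Qx Qy y0.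
  have KL0 : 0 <= KL x.1 y.1.
    by apply: le_trans (KL_pinsker Qx.1 Qy.1 y0); rewrite divr_ge0 ?sqr_ge0.
  have P0 : 0 <= l2norm (x.2 - y.2) ^+ 2 / 2 by rewrite divr_ge0 ?sqr_ge0.
  rewrite ler_norml /bregman => /andP[].
  move: (l2norm _ ^+ 2 / 2) (KL _ _) P0 KL0 => P K P0 K0.
  have [/(ler_wpM2r K0) min1 /(ler_wpM2r P0) min2] : mmin <= mu1 /\ mmin <= mu2.
    by split; rewrite ge_min lexx ?orbT.
  have [/(ler_wpM2r K0) max1 /(ler_wpM2r P0) max2] : mu1 <= mmax /\ mu2 <= mmax.
    by split; rewrite le_max lexx ?orbT.
  by move=> lo up; apply/andP; split; lra.
split; last by move=> x /bounds /andP[]; split; lra.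
split=> [|x _|x Qx]; [exact: psi_lin_convex|exact: psi_lin_diag|].
by rewrite addr0; apply/andP; exact: bounds.
Qed.
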